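(* Consider the Krasovskii-regularized Lur'e system $\dot x\in F(x)$, $y=Cx$, of the context, and suppose Assumptions 1 and 3 hold. Then the system is output finite-time stable (OFTS) and state-independent output locally asymptotically stable (SIoLAS).
   Context: System: $\dot x=Ax+Bu$, $y=Cx$, $u=-\boldsymbol\psi(y)$, $x\in\mathbb{R}^n$, $u,y\in\mathbb{R}^p$, $\boldsymbol\psi(y)=(\psi_1(y_1),\dots,\psi_p(y_p))$. Piecewise continuous: finitely many discontinuities on each bounded interval, continuous between them, finite one-sided limits. Krasovskii regularization: $\boldsymbol\Psi_i(s):=\bigcap_{\delta>0}\overline{\mathrm{co}}\,\psi_i(s+\delta[-1,1])$, $\boldsymbol\Psi(y):=\boldsymbol\Psi_1(y_1)\times\dots\times\boldsymbol\Psi_p(y_p)$, $F(x):=\{Ax-Bw:w\in\boldsymbol\Psi(Cx)\}$; solutions are absolutely continuous functions satisfying $\dot x(t)\in F(x(t))$ a.e., with output $y=Cx$. Assumption 1: for each $i$, $\psi_i$ is piecewise continuous and there is $\zeta_i\in(0,+\infty]$ with $\psi_i(s)(\psi_i(s)-\zeta_is)\le0$ for all $s$ (for $\zeta_i=+\infty$: $\psi_i(s)s\ge0$). Assumption 3: (i) $CB$ is Lyapunov diagonally stable, i.e., there is a diagonal $\overline\Gamma>0$ with $\overline\Gamma CB+(CB)^\top\overline\Gamma>0$; (ii) the origin is globally asymptotically stable for $\dot x\in F(x)$ (all maximal solutions defined on $\mathbb{R}_{\ge0}$ and there is $\beta\in\mathcal{KL}$ with $|x(t)|\le\beta(|x(0)|,t)$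 for all solutions and $t\ge0$); (iii) for each $i$, $\lim_{s\to0^+}\psi_i(s)>0$ and $\lim_{s\to0^-}\psi_i(s)<0$. Definitions (all solutions forward complete): oGAS if there is $\beta\in\mathcal{KL}$ with $|y(t)|\le\beta(|x(0)|,t)$ for all solutions and $t\ge0$; SIoLAS if there are $r>0$ and $\beta\in\mathcal{KL}$ such that every solution with $|x(0)|<r$ satisfies $|y(t)|\le\beta(|y(0)|,t)$ for all $t\ge0$; OFTS if oGAS and for each solution there is $T\in[0,\infty)$ with $y(t)=0$ for all $t\ge T$. *)

(* Defs.v *)
From HB Require Import structures.
From mathcomp Require Import all_boot all_order all_algebra.
From mathcomp Require Import all_classical all_reals all_analysis.
Set Implicit Arguments. Unset Strict Implicit. Unset Printing Implicit Defensive.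
Import Order.TTheory GRing.Theory Num.Theory.
Import numFieldNormedType.Exports.
Local Open Scope classical_set_scope.
Local Open Scope ring_scope.

Section Defs.
Variable R : realType.

Definition enorm {k : nat} (v : 'cV[R]_k) : R :=
  Num.sqrt (\sum_(i < k) (v i 0) ^+ 2).

Definition convexR (S : set R) : Prop :=
  forall a b (l : R), S a -> S b -> 0 <= l -> l <= 1 -> S (l * a + (1 - l) * b).

Definition cl_co (S : set R) : set R :=
  [set z | forall K : set R, S `<=` K -> convexR K -> closed K -> K z].

Definition kras (psi : R -> R) (s : R) : set R :=
  [set w | forall delta : R, 0 < delta ->
     cl_co (psi @` [set s + delta * e | e in `[-1, 1]%classic]) w].

Definition piecewise_continuous (psi : R -> R) : Prop :=
  (forall a b : R, finite_set [set t | a <= t <= b /\ ~ {for t, continuous psi}]) /\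
  (forall t : R, exists l : R, psi x @[x --> t^'+] --> l) /\
  (forall t : R, exists l : R, psi x @[x --> t^'-] --> l).

Definition sector (zeta : \bar R) (psi : R -> R) : Prop :=
  match zeta with
  | r%:E => forall s, psi s * (psi s - r * s) <= 0
  | +oo%E => forall s, 0 <= psi s * s
  | -oo%E => False
  end.

Definition pos_def {k : nat} (M : 'M[R]_k) : Prop :=
  forall v : 'cV[R]_k, v != 0 -> 0 < (v^T *m M *m v) 0 0.
Definition lyap_diag_stable {k : nat} (M : 'M[R]_k) : Prop :=
  exists g : 'rV[R]_k, (forall i, 0 < g 0 i) /\
    pos_def (diag_mx g *m M + M^T *m diag_mx g).

Definition classK (a : R -> R) : Prop :=
  {within `[0, +oo[%classic, continuous a} /\ a 0 = 0 /\
  (forall r s, 0 <= r -> r < s -> a r < a s).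
Definition classKL (b : R -> R -> R) : Prop :=
  (forall t, 0 <= t -> classK (fun r => b r t)) /\
  (forall r, 0 <= r -> forall t s, 0 <= t -> t <= s -> b r s <= b r t) /\
  (forall r, 0 <= r -> b r t @[t --> +oo] --> 0).

Definition tdom (T : \bar R) : set R := [set t | 0 <= t /\ (t%:E < T)%E].

Definition abs_cont_on {n : nat} (a b : R) (x : R -> 'cV[R]_n) : Prop :=
  forall eps : R, 0 < eps -> exists2 delta : R, 0 < delta &
    forall (k : nat) (u v : 'I_k -> R),
      (forall i, a <= u i /\ u i <= v i /\ v i <= b) ->
      (forall i j, i != j -> v i <= u j \/ v j <= u i) ->
      \sum_(i < k) (v i - u i) < delta ->
      \sum_(i < k) enorm (x (v i) - x (u i)) < eps.

Definition loc_abs_cont {n : nat} (T : \bar R) (x : R -> 'cV[R]_n) : Prop :=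
  forall a b, tdom T a -> tdom T b -> abs_cont_on a b x.

Definition vderivable {n : nat} (x : R -> 'cV[R]_n) (t : R) : Prop :=
  forall i : 'I_n, derivable (fun s => x s i 0) t 1.
Definition vderive {n : nat} (x : R -> 'cV[R]_n) (t : R) : 'cV[R]_n :=
  \col_i ('D_1 (fun s => x s i 0) t).

Definition is_solution {n : nat} (F : 'cV[R]_n -> set 'cV[R]_n)
    (T : \bar R) (x : R -> 'cV[R]_n) : Prop :=
  (0 < T)%E /\ loc_abs_cont T x /\
  exists N : set R, (@lebesgue_measure R).-negligible N /\
    forall t, tdom T t -> ~ N t -> vderivable x t /\ F (x t) (vderive x t).

(** Forward completeness: every solution extends to a solution on [0,+oo)
    (equivalently, all maximal solutions are defined on [0,+oo)). *)
Definition forward_complete {n : nat} (F : 'cV[R]_n -> set 'cV[R]_n) : Prop :=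
  forall T x, is_solution F T x ->
    exists2 x', is_solution F +oo%E x' & forall t, tdom T t -> x' t = x t.

Definition lure_F {n p : nat} (A : 'M[R]_n) (B : 'M[R]_(n, p)) (C : 'M[R]_(p, n))
    (psi : 'I_p -> R -> R) (x : 'cV[R]_n) : set 'cV[R]_n :=
  [set A *m x - B *m w | w in [set w : 'cV[R]_p | forall i, kras (psi i) ((C *m x) i 0) (w i 0)]].

Definition GAS {n : nat} (F : 'cV[R]_n -> set 'cV[R]_n) : Prop :=
  forward_complete F /\ exists2 b, classKL b &
    forall T x, is_solution F T x -> forall t, tdom T t -> enorm (x t) <= b (enorm (x 0)) t.

Definition oGAS {n p : nat} (F : 'cV[R]_n -> set 'cV[R]_n) (C : 'M[R]_(p, n)) : Prop :=
  forward_complete F /\ exists2 b, classKL b &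
    forall T x, is_solution F T x -> forall t, tdom T t ->
      enorm (C *m x t) <= b (enorm (x 0)) t.

Definition SIoLAS {n p : nat} (F : 'cV[R]_n -> set 'cV[R]_n) (C : 'M[R]_(p, n)) : Prop :=
  forward_complete F /\ exists r : R, 0 < r /\ exists2 b, classKL b &
    forall T x, is_solution F T x -> enorm (x 0) < r -> forall t, tdom T t ->
      enorm (C *m x t) <= b (enorm (C *m x 0)) t.

Definition OFTS {n p : nat} (F : 'cV[R]_n -> set 'cV[R]_n) (C : 'M[R]_(p, n)) : Prop :=
  oGAS F C /\
  forall x, is_solution F +oo%E x ->
    exists2 T0 : R, 0 <= T0 & forall t, T0 <= t -> C *m x t = 0.

End Defs.

(* Main.v *)
Require Import Defs.
From HB Require Import structures.
From mathcomp Require Import all_boot all_order all_algebra.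
From mathcomp Require Import all_classical all_reals all_analysis.
From mathcomp Require Import measurable_realfun ring lra.
Set Implicit Arguments.
Unset Strict Implicit.
Unset Printing Implicit Defensive.
Import Order.TTheory GRing.Theory Num.Theory.
Import numFieldNormedType.Exports.
Local Open Scope classical_set_scope.
Local Open Scope ring_scope.

(* Let [lp i > 0 > lm i] be the one-sided limits of [psi i] at 0. The Lyapunov
   function is [V y = \sum_i g i * vee (lp i) (lm i) (y i)], where [vee lp lm] is
   piecewise linear with slopes [lp] and [lm] on the two half-lines and [g] is a
   diagonal stability certificate of [C B]. Near the origin every
   [w i] in the Krasovskii set at [y i <> 0] is close to the slope [h i] of [vee]
   at [y i]; where [y i = 0], almost everywhere [y i] also has zero derivative,
   so that [h i := w i] may be taken there. Hence almost everywhere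
   [V' = h^T g (C A x - C B (w - h)) - h^T g C B h], and the coercivity of
   [g C B] together with [|h| >= m > 0] for [y <> 0] gives [V' <= - c < 0] as
   soon as [x] is small. Global asymptotic stability keeps [x] small, so [V]
   vanishes after a time linear in its initial value; as [V] is comparable to
   [|y|], the decay of [y] is controlled by [|y 0|] alone. *)

(** * Growth of absolutely continuous functions from almost-everywhere slopes *)

(** A step can start at a point of [P] just left of the supremum of such points; it reaches [b], or
    else lands strictly beyond the supremum. *)
Lemma real_induction (R : realType) (a b : R) (P : R -> Prop) :
  a <= b -> P a ->
  (forall t, a <= t <= b -> exists2 e : R, 0 < e &
     forall s s', a <= s -> t - e < s -> s <= t -> t <= s' -> s' < t + e ->
       s' <= b -> P s -> P s') ->
  P b.
Proof.
move=> ab Pa step.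
pose S := [set t | a <= t <= b /\ P t].
have Sa : S a by split=> //; rewrite lexx.
have Sb : ubound S b by move=> t [/andP[]].
have S0 : S !=set0 by exists a.
have Sub : has_ubound S by exists b.
have ac : a <= sup S by apply: ub_le_sup.
have cb : sup S <= b by exact: ge_sup.
have [|e e0 He] := step (sup S); first by rewrite ac cb.
have [s Ss es] := sup_adherent e0 (conj S0 Sub).
have sc : s <= sup S by apply: ub_le_sup.
have [/andP[as_ sb] Ps] := Ss.
have [bc|cb'] := leP b (sup S + e / 2).
  by apply: (He s b) => //; lra.
have Pc : P (sup S + e / 2) by apply: (He s) => //; lra.
have : sup S + e / 2 <= sup S.
  apply: ub_le_sup; first by [].
  by split=> //; apply/andP; split; lra.
by move=> ?; exfalso; lra.
Qed.

(** The derivative as a relation, free of quotients: the inequality makes sense at [s = t], and sums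
    and multiples of slopes are handled directly. *)
Definition has_slope (R : realType) (f : R -> R) (t d : R) : Prop :=
  forall e : R, 0 < e ->
    \forall s \near t, `|f s - f t - d * (s - t)| <= e * `|s - t|.

Definition abs_cont (R : realType) (a b : R) (f : R -> R) : Prop :=
  forall eps : R, 0 < eps -> exists2 delta : R, 0 < delta &
    forall (k : nat) (u v : 'I_k -> R),
      (forall i, a <= u i /\ u i <= v i /\ v i <= b) ->
      (forall i j, i != j -> v i <= u j \/ v j <= u i) ->
      \sum_(i < k) (v i - u i) < delta ->
      \sum_(i < k) `|f (v i) - f (u i)| < eps.

Lemma negligible_open_cover (R : realType) (N : set R) (eps : R) :
  (@lebesgue_measure R).-negligible N -> 0 < eps ->
  exists U : set R,
    [/\ open U, N `<=` U & (@lebesgue_measure R U < eps%:E)%E].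
Proof.
move=> [A [mA A0 NA]] e0.
have [|U [oU AU UA]] := lebesgue_regularity_outer mA _ e0.
  by rewrite [ltLHS]A0.
exists U; split=> //; first exact: subset_trans AU.
rewrite -(setDUK AU) measureU ?[X in (X + _ < _)%E]A0 ?add0e//.
- by apply: measurableD => //; exact: open_measurable.
- exact: setDIK.
Qed.

(** Half-open intervals stay disjoint when two of them share an endpoint, so the measure adds up
    over them. *)
Lemma sum_length_le (R : realType) (U : set R) k (u v : 'I_k -> R) :
  measurable U -> (forall i, u i <= v i) ->
  (forall i j, i != j -> v i <= u j \/ v j <= u i) ->
  (forall i, `]u i, v i] `<=` U) ->
  ((\sum_(i < k) (v i - u i))%:E <= @lebesgue_measure R U)%E.
Proof.
move=> mU uv dis sub.
rewrite -sumEFin.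
have -> : (\sum_(i < k) (v i - u i)%:E)%E =
    (\sum_(i < k) @lebesgue_measure R `]u i, v i]%classic)%E.
  apply: eq_bigr => i _; rewrite lebesgue_measure_itv/= lte_fin.
  have [//|vu] := ltP (u i) (v i).
  by rewrite (le_anti (_ : u i <= v i <= u i)) ?subrr// uv.
rewrite -(@measure_bigsetU_ord _ _ _ (@lebesgue_measure R) k xpredT
  (fun i => `]u i, v i]%classic)) //.
- apply: le_measure; rewrite ?inE//.
    by apply: bigsetU_measurable => i _; exact: measurable_itv.
  by elim/big_ind : _ => // X Y XU YU x [/XU|/YU].
- apply/trivIsetP => i j _ _ ij; rewrite -subset0 => x [] /=.
  rewrite !in_itv/= => /andP[x1 x2] /andP[x3 x4].
  by case: (dis _ _ ij) => ?; lra.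
Qed.

(* Real induction on [P t]: the increment of [f] on [a, t] is bounded by
   [e1 * (t - a)] plus its variation over finitely many disjoint intervals inside
   an open set [U] of small measure that covers the exceptional set. *)
Lemma abs_cont_slope_le0 (R : realType) (a b : R) (f : R -> R) (N : set R) :
  a <= b -> abs_cont a b f -> (@lebesgue_measure R).-negligible N ->
  (forall t, a <= t <= b -> ~ N t -> exists2 d, d <= 0 & has_slope f t d) ->
  f b <= f a.
Proof.
move=> ab acf N0 Hd; rewrite -subr_le0; apply/ler_addgt0Pr => e e0; rewrite add0r.
(* The [+ 1] keeps the denominator positive when [a = b]. The slope error over the whole interval is
   at most [e / 2]; the variation inside [U] takes the other half. *)
pose e1 := e / 2 / (b - a + 1).
have ba1 : 0 < b - a + 1 by lra.
have e10 : 0 < e1 by rewrite !divr_gt0.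
have [delta d0 Hac] := acf (e / 2) (divr_gt0 e0 (ltr0Sn _ _)).
have [U [oU NU Ud]] := negligible_open_cover N0 d0.
pose P t := exists m (u v : 'I_m -> R),
  [/\ forall i, a <= u i /\ u i <= v i /\ v i <= t,
      forall i j, i != j -> v i <= u j \/ v j <= u i,
      forall i, `]u i, v i] `<=` U &
      f t - f a <= e1 * (t - a) + \sum_(i < m) `|f (v i) - f (u i)|].
have : P b.
  apply: (real_induction ab) => //.
    exists 0, (fun=> a), (fun=> a).
    by split=> [[]|[]|[]|]//; rewrite big_ord0 !subrr mulr0 addr0.
  move=> t atb.
  have [Nt|nNt] := pselect (N t).
    have /nbhs_ballP[r r0 Hr] : nbhs t U by apply: open_nbhs_nbhs; split=> //; exact: NU.
    exists r => // s s' as_ ts st ts' s't sb [m [u [v [uv dis UU le]]]].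
    (* At an exceptional point the increment from [s] to [s'] is charged to a new interval []s,
       s']], which lies in [U]. *)
    exists m.+1, (fun i => if unlift ord0 i is Some j then u j else s),
      (fun i => if unlift ord0 i is Some j then v j else s').
    split.
    - move=> i; case: unliftP => [j|] _ /=; last by split; [lra|split; lra].
      have [? [? ?]] := uv j. split; [|split]; lra.

    - move=> i j; case: unliftP => [i'|] ->; case: unliftP => [j'|] ->.
      + by rewrite (inj_eq lift_inj) => /dis.
      + by move=> _; left; have := (uv i').2.2.
      + by move=> _; right; have := (uv j').2.2.
      + by rewrite eqxx.
    - move=> i; case: unliftP => [j|] _; first exact: UU.
      move=> x /=; rewrite in_itv/= => /andP[sx xs].
      by apply: Hr; rewrite /ball/= ltr_norml; apply/andP; split; lra.
    - rewrite big_ord_recl unlift_none.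
      under eq_bigr => i _ do rewrite liftK.
      have := ler_norm (f s' - f s).
      have : 0 <= e1 * (s' - s) by rewrite mulr_ge0//; lra.
      lra.
  (* Off the exceptional set no interval is added: as [d <= 0], the slope estimates at [s] and [s'],
     on either side of [t], give an increment of at most [e1 * (s' - s)]. *)
  have [d dk sl] := Hd t atb nNt.
  have /nbhs_ballP[r r0 Hr] := sl e1 e10.
  exists r => // s s' as_ ts st ts' s't sb [m [u [v [uv dis UU le]]]].
  exists m, u, v; split=> //.
    by move=> i; have [? [? ?]] := uv i; split; [|split]; lra.
  have Hs : `|f s - f t - d * (s - t)| <= e1 * `|s - t|.
    by apply: Hr; rewrite /ball/= ltr_norml; apply/andP; split; lra.
  have Hs' : `|f s' - f t - d * (s' - t)| <= e1 * `|s' - t|.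
    by apply: Hr; rewrite /ball/= ltr_norml; apply/andP; split; lra.
  rewrite [X in _ <= _ * X]ler0_norm in Hs; last by lra.
  rewrite [X in _ <= _ * X]ger0_norm in Hs'; last by lra.
  have h1 : 0 <= - d * (s' - s) by rewrite mulr_ge0//; lra.
  move: Hs Hs'; rewrite !ler_norml => /andP[h2 h3] /andP[h4 h5].
  lra.
move=> [m [u [v [uv dis UU le]]]].
have len : \sum_(i < m) (v i - u i) < delta.
  rewrite -lte_fin; apply: le_lt_trans Ud.
  apply: sum_length_le => //; first exact: open_measurable.
  by move=> i; have [? []] := uv i.
have := Hac m u v uv dis len.
have : e1 * (b - a) <= e / 2.
  rewrite /e1 -mulrA ler_piMr//; first by lra.
  by rewrite mulrC ler_pdivrMr// mul1r; lra.
lra.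
Qed.

(** Subtracting the line [k * t] reduces this to nonpositive slopes; the line adds at most [|k|]
    times the total length to the variation. *)
Lemma abs_cont_slope_le (R : realType) (a b k : R) (f : R -> R) (N : set R) :
  a <= b -> abs_cont a b f -> (@lebesgue_measure R).-negligible N ->
  (forall t, a <= t <= b -> ~ N t -> exists2 d, d <= k & has_slope f t d) ->
  f b - f a <= k * (b - a).
Proof.
move=> ab acf N0 Hd.
suff : f b - k * b <= f a - k * a by lra.
apply: (@abs_cont_slope_le0 _ a b (fun t => f t - k * t) N) => //.
- move=> e e0; have [delta d0 Hac] := acf (e / 2) (divr_gt0 e0 (ltr0Sn _ _)).
  have k0 : 0 < `|k| + 1 by rewrite ltr_wpDl.
  exists (Num.min delta (e / 2 / (`|k| + 1))).
    by rewrite lt_min d0 !divr_gt0.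
  move=> m u v uv dis; rewrite lt_min ltr_pdivlMr// => /andP[s1 s2].
  have S := Hac m u v uv dis s1.
  apply: (@le_lt_trans _ _ (\sum_(i < m) `|f (v i) - f (u i)| +
      `|k| * \sum_(i < m) (v i - u i))).
    rewrite mulr_sumr -big_split/=; apply: ler_sum => i _.
    have [_ [uvi _]] := uv i.
    rewrite (_ : _ - _ = (f (v i) - f (u i)) - k * (v i - u i)); last by ring.
    apply: (le_trans (ler_normB _ _)).
    by rewrite normrM (ger0_norm (_ : 0 <= v i - u i))// subr_ge0.
  have : 0 <= \sum_(i < m) (v i - u i).
    by apply: sumr_ge0 => i _; have [_ [uvi _]] := uv i; rewrite subr_ge0.
  lra.
- move=> t atb nNt; have [d dk sl] := Hd t atb nNt.
  exists (d - k); first by lra.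
  move=> e /sl; apply: filterS => s.
  by rewrite (_ : f s - k * s - _ - _ = f s - f t - d * (s - t))//; ring.
Qed.


(** * Coercivity of positive definite and diagonally stable matrices *)

Lemma pos_def_unitmx (R : realType) k (M : 'M[R]_k) :
  pos_def M -> M \in unitmx.
Proof.
move=> Mpos; rewrite -row_free_unit -kermx_eq0; apply/negPn/negP.
move=> /rowV0Pn[w /sub_kermxP wM w0].
have := Mpos w^T; rewrite trmxK wM mul0mx mxE ltxx.
by rewrite trmx_eq0 => /(_ w0).
Qed.

(* Cauchy-Schwarz for the inner product of [M], applied to [v] and
   [invmx M *m e_i], bounds the coordinate [v i 0]. *)
Lemma pos_def_coercive (R : realType) k (M : 'M[R]_k) :
  M^T = M -> pos_def M ->
  exists2 lam : R, 0 < lam &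
    forall v : 'cV[R]_k, lam * \sum_i (v i 0) ^+ 2 <= (v^T *m M *m v) 0 0.
Proof.
move=> Msym Mpos; have Mu := pos_def_unitmx Mpos.
have Mge0 (v : 'cV[R]_k) : 0 <= (v^T *m M *m v) 0 0.
  have [->|/Mpos/ltW//] := eqVneq v 0.
  by rewrite mulmx0 mxE.
pose u (i : 'I_k) : 'cV[R]_k := invmx M *m delta_mx i 0.
have uM i (v : 'cV[R]_k) : ((u i)^T *m M *m v) 0 0 = v i 0.
  rewrite /u trmx_mul trmx_inv Msym mulmxKV// trmx_delta.
  by rewrite -rowE mxE.
have vMu i (v : 'cV[R]_k) : (v^T *m M *m u i) 0 0 = v i 0.
  have -> : v^T *m M *m u i = ((u i)^T *m M *m v)^T.
    by rewrite (trmx_mul _ v) (trmx_mul _ M) trmxK Msym mulmxA.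
  by rewrite mxE uM.
pose a i := ((u i)^T *m M *m u i) 0 0.
have u_neq0 i : u i != 0.
  apply/negP => /eqP ui0; have : M *m u i = delta_mx i 0 by rewrite mulKVmx.
  rewrite ui0 mulmx0 => /matrixP/(_ i 0); rewrite !mxE !eqxx/=.
  by move/eqP; rewrite eq_sym oner_eq0.
have a_gt0 i : 0 < a i by exact: Mpos.
have bound (v : 'cV[R]_k) i : (v i 0) ^+ 2 <= a i * (v^T *m M *m v) 0 0.
  (* This [c] minimises the quadratic form along [v - c *: u i]; nonnegativity at the minimum is the
     Cauchy-Schwarz inequality. *)
  set c := v i 0 / a i; have := Mge0 (v - c *: u i).
  have -> : (v - c *: u i)^T *m M *m (v - c *: u i) = v^T *m M *m v
      - c *: (v^T *m M *m u i) - c *: ((u i)^T *m M *m v)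
      + (c * c) *: ((u i)^T *m M *m u i).
    rewrite (_ : (v - _)^T = v^T - c *: (u i)^T); last first.
      by apply/matrixP => ? ?; rewrite !mxE.
    rewrite mulmxBr !mulmxBl -!scalemxAr -!scalemxAl scalerA.
    by rewrite opprB addrA addrAC [X in X + _]addrAC.
  have -> (X Y Z W : 'M[R]_1) : (X - c *: Y - c *: Z + (c * c) *: W) 0 0 =
      X 0 0 - c * Y 0 0 - c * Z 0 0 + c * c * W 0 0 by rewrite !mxE.
  have ca : c * a i = v i 0 by rewrite divfK// gt_eqF.
  rewrite uM vMu -/(a i) -[c * c * _]mulrA ca subrK subr_ge0 => cv.
  by rewrite expr2 -{1}ca mulrAC mulrC ler_pM2l.
(* The [1 +] keeps the constant positive when [k = 0]. *)
exists (1 + \sum_i a i)^-1.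
  by rewrite invr_gt0 ltr_pwDl// sumr_ge0// => i _; exact/ltW.
move=> v; rewrite mulrC ler_pdivrMr; last first.
  by rewrite ltr_pwDl// sumr_ge0// => i _; exact/ltW.
rewrite mulrC mulrDl mul1r ler_wpDl// mulr_suml.
by apply: ler_sum => i _; exact: bound.
Qed.

(** The two summands of the symmetrised matrix are transposes of each other and define the same
    quadratic form, so each is coercive with half the constant. *)
Lemma lyap_diag_stable_coercive (R : realType) k (M : 'M[R]_k) :
  lyap_diag_stable M -> exists g : 'I_k -> R, (forall i, 0 < g i) /\
  exists2 lam : R, 0 < lam & forall v : 'cV[R]_k,
    lam * \sum_i (v i 0) ^+ 2 <= \sum_i g i * v i 0 * (M *m v) i 0.
Proof.
move=> [g [g0 gM]]; exists (fun i => g 0 i); split=> //.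
have [|lam lam0 Hl] := pos_def_coercive _ gM.
  by rewrite linearD/= !trmx_mul trmxK tr_diag_mx addrC.
exists (lam / 2); first by rewrite divr_gt0.
move=> v; have := Hl v.
have E : (v^T *m (diag_mx g *m M) *m v) 0 0 =
    \sum_i g 0 i * v i 0 * (M *m v) i 0.
  rewrite -mulmxA -mulmxA mulmxA mul_mx_diag mxE; apply: eq_bigr => i _.
  by rewrite !mxE (mulrC (g _ _)).
have E' : (v^T *m (M^T *m diag_mx g) *m v) 0 0 =
    (v^T *m (diag_mx g *m M) *m v) 0 0.
  have -> : v^T *m (M^T *m diag_mx g) *m v = (v^T *m (diag_mx g *m M) *m v)^T.
    by rewrite !trmx_mul trmxK tr_diag_mx !mulmxA.
  by rewrite mxE.
rewrite mulmxDr mulmxDl mxE E' E; lra.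
Qed.

(** * Euclidean norm estimates *)

Lemma le_enorm (R : realType) k (x : 'cV[R]_k) i : `|x i 0| <= enorm x.
Proof.
rewrite -sqrtr_sqr ler_sqrt ?sumr_ge0// => [|j _]; last exact: sqr_ge0.
by rewrite (bigD1 i)//= lerDl sumr_ge0// => j _; exact: sqr_ge0.
Qed.

Lemma enorm_ge0 (R : realType) k (x : 'cV[R]_k) : 0 <= enorm x.
Proof. exact: sqrtr_ge0. Qed.

Lemma enorm_le_sum (R : realType) k (x : 'cV[R]_k) :
  enorm x <= \sum_i `|x i 0|.
Proof.
have S0 : 0 <= \sum_i `|x i 0| by exact: sumr_ge0.
rewrite -[leRHS]ger0_norm// -sqrtr_sqr ler_sqrt ?sqr_ge0//.
rewrite expr2 mulr_suml; apply: ler_sum => i _.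
rewrite -real_normK ?num_real// expr2 ler_wpM2l//.
by rewrite (bigD1 i)//= lerDl sumr_ge0.
Qed.

Lemma mulmx_le_enorm (R : realType) m k (M : 'M[R]_(m, k)) :
  exists2 K : R, 0 < K &
    forall (x : 'cV[R]_k) i, `|(M *m x) i 0| <= K * enorm x.
Proof.
exists (1 + \sum_i \sum_j `|M i j|).
  by rewrite ltr_pwDl// sumr_ge0// => i _; exact: sumr_ge0.
move=> x i; rewrite mulrDl mul1r ler_wpDl ?enorm_ge0//.
apply: (@le_trans _ _ ((\sum_j `|M i j|) * enorm x)); last first.
  rewrite ler_wpM2r ?enorm_ge0// [leRHS](bigD1 i)//= lerDl.
  by apply: sumr_ge0 => ? _; exact: sumr_ge0.
rewrite mxE mulr_suml (le_trans (ler_norm_sum _ _ _))//.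
by apply: ler_sum => j _; rewrite normrM ler_wpM2l// le_enorm.
Qed.

(** * Krasovskii sets near the origin *)

(** The interval [[l - e, l + e]] is closed and convex, so it contains the closed convex hull for
    this [delta], hence the intersection over all of them. *)
Lemma kras_sub_itv (R : realType) (psi : R -> R) (s delta l e w : R) :
  0 < delta -> (forall x, `|x - s| <= delta -> `|psi x - l| <= e) ->
  kras psi s w -> `|w - l| <= e.
Proof.
move=> d0 H /(_ _ d0) /(_ `[l - e, l + e]%classic) /=.
rewrite in_itv/= -ler_distl; apply.
- move=> _ [x [r /= r1 <-] <-]; move: r1; rewrite in_itv/= => r1.
  rewrite /= in_itv/= -ler_distl; apply: H; rewrite addrAC subrr add0r normrM gtr0_norm//.
  by rewrite ler_piMr ?(ltW d0)// ler_norml.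
- move=> x y r /=; rewrite !in_itv/= => /andP[x1 x2] /andP[y1 y2] r0 r1.
  have h1 : 0 <= r * (x - (l - e)) by rewrite mulr_ge0// subr_ge0.
  have h2 : 0 <= (1 - r) * (y - (l - e)) by rewrite mulr_ge0// subr_ge0.
  have h3 : 0 <= r * (l + e - x) by rewrite mulr_ge0// subr_ge0.
  have h4 : 0 <= (1 - r) * (l + e - y) by rewrite mulr_ge0// subr_ge0.
  by apply/andP; split; lra.
- exact: interval_closed.
Qed.

Lemma kras_near_right (R : realType) (psi : R -> R) (l e : R) :
  psi s @[s --> 0^'+] --> l -> 0 < e ->
  \forall eta \near 0^'+, forall s w, 0 < s < eta -> kras psi s w ->
    `|w - l| <= e.
Proof.
move=> /cvgrPdist_le cl e0; have := cl e e0.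
rewrite near_withinE => /nbhs_ballP[r /= r0 Hr].
near=> eta => s w /andP[s0 se].
(* This radius keeps the window around [s] inside []0, eta[], clear of the possible jump at 0. *)
apply: (@kras_sub_itv _ _ _ (Num.min (s / 2) ((eta - s) / 2))).
  by rewrite lt_min !divr_gt0// subr_gt0.
move=> x; rewrite le_min => /andP[]; rewrite ler_norml => /andP[x1 x1'].
rewrite ler_norml => /andP[x2 x2']; rewrite distrC; apply: Hr => /=; last by lra.
rewrite /ball/= sub0r normrN gtr0_norm; last by lra.
have : eta < r by near: eta; exact: nbhs_right_lt.
lra.
Unshelve. all: by end_near. Qed.

Lemma kras_near_left (R : realType) (psi : R -> R) (l e : R) :
  psi s @[s --> 0^'-] --> l -> 0 < e ->
  \forall eta \near 0^'+, forall s w, - eta < s < 0 -> kras psi s w ->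
    `|w - l| <= e.
Proof.
move=> /cvgrPdist_le cl e0; have := cl e e0.
rewrite near_withinE => /nbhs_ballP[r /= r0 Hr].
near=> eta => s w /andP[se s0].
apply: (@kras_sub_itv _ _ _ (Num.min (- s / 2) ((eta + s) / 2))).
  by rewrite lt_min; apply/andP; split; lra.
move=> x; rewrite le_min => /andP[]; rewrite ler_norml => /andP[x1 x1'].
rewrite ler_norml => /andP[x2 x2']; rewrite distrC; apply: Hr => /=; last by lra.
rewrite /ball/= sub0r normrN ltr0_norm; last by lra.
have : eta < r by near: eta; exact: nbhs_right_lt.
lra.
Unshelve. all: by end_near. Qed.

(** * Calculus of slopes *)

Lemma has_slope_sum (R : realType) (I : finType) (f : I -> R -> R) t (d : I -> R) :
  (forall i, has_slope (f i) t (d i)) ->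
  has_slope (fun s => \sum_i f i s) t (\sum_i d i).
Proof.
move=> H e e0; pose e1 := e / (#|I|%:R + 1).
have e10 : 0 < e1 by rewrite divr_gt0// ltr_wpDl.
have HF := filter_forall (nbhs_filter t) (fun i => H i e1 e10).
apply: filterS HF => s Hs.
rewrite mulr_suml -!sumrB (le_trans (ler_norm_sum _ _ _))//.
apply: (@le_trans _ _ (\sum_(i : I) e1 * `|s - t|)); first exact: ler_sum.
rewrite sumr_const -mulr_natl mulrA ler_wpM2r//.
by rewrite /e1 mulrCA ler_piMr ?ltW// ltr_pdivrMr ?ltr_wpDl// mul1r ltrDl.
Qed.

Lemma has_slopeZ (R : realType) (f : R -> R) t d c :
  has_slope f t d -> has_slope (fun s => c * f s) t (c * d).
Proof.
move=> H e e0; pose e1 := e / (`|c| + 1).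
have c1 : 0 < `|c| + 1 by rewrite ltr_wpDl.
have e10 : 0 < e1 by rewrite divr_gt0.
apply: filterS (H e1 e10) => s Hs.
rewrite -mulrA -!mulrBr normrM (le_trans (ler_wpM2l _ Hs))// mulrA.
rewrite ler_wpM2r// mulrCA ler_piMr ?ltW// ltr_pdivrMr// mul1r ltrDl//.
Qed.

Lemma derivable_has_slope (R : realType) (f : R -> R) t :
  derivable f t 1 -> has_slope f t ('D_1 f t).
Proof.
move=> df e e0; have /cvgrPdist_le/(_ e e0) := df.
rewrite near_withinE => /nbhs_ballP[r /= r0 Hr].
apply/nbhs_ballP; exists r => // s; rewrite /ball/= distrC => st.
have [->|neq] := eqVneq s t; first by rewrite !subrr mulr0 subrr normr0 mulr0.
have st0 : s - t != 0 by rewrite subr_eq0.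
have := Hr (s - t); rewrite /ball/= sub0r normrN => /(_ st st0).
rewrite [_ *: 1]mulr1 subrK distrC => H.
rewrite (_ : f s - f t - _ = (s - t) * ((s - t)^-1 *: (f s - f t) - 'D_1 f t)).
  by rewrite normrM mulrC ler_wpM2r.
have -> : (s - t)^-1 *: (f s - f t) = (s - t)^-1 * (f s - f t) by [].
by rewrite [RHS]mulrBr mulVKf// [_ * (s - t)]mulrC.
Qed.

Lemma has_slope_cvg (R : realType) (f : R -> R) (t d : R) :
  has_slope f t d -> f s @[s --> t] --> f t.
Proof.
move=> H; apply/cvgrPdist_le => e e0.
have k0 : 0 < 1 + `|d| by rewrite ltr_pwDl.
have HF := H 1 ltr01.
apply: filterS2 HF (nbhsx_ballx t _ (divr_gt0 e0 k0)) => s.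
rewrite /ball/= ltr_pdivlMr// mul1r (distrC (f t)) (distrC t) => Hs st.
have Hd : `|d * (s - t)| = `|d| * `|s - t| by rewrite normrM.
have := ler_normD (f s - f t - d * (s - t)) (d * (s - t)).
rewrite subrK; lra.
Qed.

(** * The piecewise linear terms of the Lyapunov function *)

Definition vee (R : realType) (lp lm s : R) : R :=
  if 0 <= s then lp * s else lm * s.

Lemma vee_lipschitz (R : realType) (lp lm s t : R) : lm < 0 -> 0 < lp ->
  `|vee lp lm s - vee lp lm t| <= (lp - lm) * `|s - t|.
Proof.
move=> lm0 lp0; rewrite /vee.
have mulp x : 0 <= x -> 0 <= lp * x by move=> x0; rewrite mulr_ge0// ltW.
have mulm x : 0 <= x -> 0 <= - lm * x.
  by move=> x0; rewrite mulr_ge0// oppr_ge0 ltW.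
have [s0|s0] := leP 0 s; have [t0|t0] := leP 0 t.
- rewrite -mulrBr normrM gtr0_norm// ler_wpM2r//; lra.
- rewrite (gtr0_norm (_ : 0 < s - t)); last by lra.
  have [h1 h2] := (mulp _ s0, mulm _ s0).
  have t0' : 0 <= - t by lra.
  have [h3 h4] := (mulp _ t0', mulm _ t0').
  by rewrite ler_norml; apply/andP; split; lra.
- rewrite (ltr0_norm (_ : s - t < 0)); last by lra.
  have [h1 h2] := (mulp _ t0, mulm _ t0).
  have s0' : 0 <= - s by lra.
  have [h3 h4] := (mulp _ s0', mulm _ s0').
  by rewrite ler_norml; apply/andP; split; lra.
- rewrite -mulrBr normrM ltr0_norm// ler_wpM2r//; lra.
Qed.

Lemma vee_ge (R : realType) (lp lm m s : R) : m <= lp -> m <= - lm ->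
  m * `|s| <= vee lp lm s.
Proof.
move=> mp mm; rewrite /vee; have [s0|s0] := leP 0 s.
  by rewrite ger0_norm// ler_wpM2r.
rewrite ltr0_norm// mulrN -mulNr ler_wnM2r ?(ltW s0)//; lra.
Qed.

Lemma vee0 (R : realType) (lp lm : R) : vee lp lm 0 = 0.
Proof. by rewrite /vee lexx mulr0. Qed.

(* At the kink the slope is the free parameter [w]. *)
Definition vee_slope (R : realType) (lp lm w s : R) : R :=
  if 0 < s then lp else if s < 0 then lm else w.

(** Away from the kink, composition is locally a scaling. At the kink [d = 0], and the Lipschitz
    bound makes the composite flat there, whatever [w] is. *)
Lemma has_slope_vee (R : realType) (lp lm w : R) (f : R -> R) t d :
  lm < 0 -> 0 < lp -> has_slope f t d -> (f t = 0 -> d = 0) ->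
  has_slope (fun s => vee lp lm (f s)) t (vee_slope lp lm w (f t) * d).
Proof.
move=> lm0 lp0 fd d0; have fc := has_slope_cvg fd.
rewrite /vee_slope; have [ft|ft|ft] := ltgtP 0 (f t).
- move=> e e0; have HF := has_slopeZ lp fd e0.
  have HG : \forall s \near t, 0 < f s by exact: cvgr_gt fc _ ft.
  apply: filterS2 HF HG => s Hs fs.
  by rewrite /vee (ltW fs) (ltW ft).
- move=> e e0; have HF := has_slopeZ lm fd e0.
  have HG : \forall s \near t, f s < 0 by exact: cvgr_lt fc _ ft.
  apply: filterS2 HF HG => s Hs fs.
  by rewrite /vee [0 <= f s]leNgt [0 <= f t]leNgt fs ft.
- move=> e e0; rewrite (d0 (esym ft)) mulr0.
  have L0 : 0 < lp - lm by lra.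
  apply: filterS (fd _ (divr_gt0 e0 L0)) => s.
  rewrite -ft (d0 (esym ft)) mul0r !subr0 vee0 subr0 => fs.
  have := vee_lipschitz (f s) 0 lm0 lp0; rewrite vee0 !subr0 => /le_trans; apply.
  by rewrite mulrC -ler_pdivlMr// mulrAC.
Qed.

(** Any other zero near [t] would contradict the slope estimate with error [|d| / 2]. Isolated
    points being countable, almost every zero of an output coordinate has slope 0. *)
Lemma has_slope_isolated (R : realType) (f : R -> R) t d :
  has_slope f t d -> d != 0 -> f t = 0 -> isolated [set s | f s = 0] t.
Proof.
move=> fd d0 ft; split; first by rewrite inE.
have d2 : 0 < `|d| / 2 by rewrite divr_gt0// normr_gt0.
exists [set s | `|f s - f t - d * (s - t)| <= `|d| / 2 * `|s - t|].
  exact: fd.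
apply/seteqP; split=> [s [/= + fs]|s ->]; last first.
  by split=> //=; rewrite ft !subrr mulr0 subrr normr0 mulr0.
rewrite fs ft subrr sub0r normrN normrM -subr_ge0 -mulrBl.
have -> : `|d| / 2 - `|d| = - (`|d| / 2) by lra.
rewrite mulNr oppr_ge0 pmulr_rle0// normr_le0 subr_eq0 => /eqP//.
Qed.

(** * The dissipation inequality near the origin *)

(** Young's inequality lets half of the coercive term absorb the part of the perturbation quadratic
    in [v]; the remainder is of order [D ^+ 2]. *)
Lemma coercive_dissipation (R : realType) k (M : 'M[R]_k) (g : 'I_k -> R)
    (lam m : R) :
  0 < lam -> 0 < m ->
  (forall v : 'cV[R]_k,
    lam * \sum_i (v i 0) ^+ 2 <= \sum_i g i * v i 0 * (M *m v) i 0) ->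
  exists D c : R, [/\ 0 < D, 0 < c & forall d v : 'cV[R]_k,
    (forall i, `|d i 0| <= D) -> (exists i, m <= `|v i 0|) ->
    \sum_i g i * v i 0 * (d - M *m v) i 0 <= - c].
Proof.
move=> lam0 m0 Hg.
pose G := 1 + \sum_i g i ^+ 2.
have G1 : 1 <= G by rewrite lerDl sumr_ge0// => i _; exact: sqr_ge0.
have G0 : 0 < G by exact: lt_le_trans G1.
(* With this [D] the remainder [D ^+ 2 / (2 * lam) * G] equals [lam * m ^+ 2 / (8 * G)], and
   [G >= 1]. The total is at most [- 3 / 8 * lam * m ^+ 2]. *)
have [D DE] : exists D, D = lam * m / (2 * G) by eexists.
have D0 : 0 < D by rewrite DE divr_gt0 ?mulr_gt0.
exists D, (lam * m ^+ 2 / 4); split=> //.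
  by rewrite divr_gt0// mulr_gt0// exprn_gt0.
move=> d v dD [i mi].
have young j : g j * v j 0 * d j 0 <=
    lam / 2 * (v j 0) ^+ 2 + D ^+ 2 / (2 * lam) * g j ^+ 2.
  have dj : (d j 0) ^+ 2 <= D ^+ 2.
    by rewrite -[leLHS]real_normK ?num_real// ler_sqr ?nnegrE// ltW.
  have : g j ^+ 2 * (d j 0) ^+ 2 <= g j ^+ 2 * D ^+ 2.
    by rewrite ler_wpM2l// sqr_ge0.
  have := sqr_ge0 (lam * v j 0 - g j * d j 0).
  rewrite sqrrB !exprMn => h1 h2.
  rewrite -(ler_pM2l (_ : 0 < 2 * lam)); last by rewrite mulr_gt0.
  rewrite mulrDr [leRHS](_ : _ =
      lam ^+ 2 * v j 0 ^+ 2 + g j ^+ 2 * D ^+ 2); last first.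
    by field; rewrite gt_eqF.
  lra.
have vm : m ^+ 2 <= \sum_j (v j 0) ^+ 2.
  rewrite (bigD1 i)//=; apply: ler_wpDr.
    by apply: sumr_ge0 => ? _; exact: sqr_ge0.
  by rewrite -[leRHS]real_normK ?num_real// ler_sqr// nnegrE// ltW.
have -> : \sum_j g j * v j 0 * (d - M *m v) j 0 =
    \sum_j g j * v j 0 * d j 0 - \sum_j g j * v j 0 * (M *m v) j 0.
  by rewrite -sumrB; apply: eq_bigr => j _; rewrite -mulrBr !mxE.
have s1 : \sum_j g j * v j 0 * d j 0 <=
    lam / 2 * (\sum_j v j 0 ^+ 2) + D ^+ 2 / (2 * lam) * (\sum_j g j ^+ 2).
  by rewrite !mulr_sumr -big_split/=; apply: ler_sum => j _; exact: young.
have s2 : D ^+ 2 / (2 * lam) * (\sum_j g j ^+ 2) <= lam * m ^+ 2 / 8.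
  apply: (@le_trans _ _ (D ^+ 2 / (2 * lam) * G)).
    by rewrite ler_wpM2l ?lerDr// divr_ge0 ?sqr_ge0// mulr_ge0// ltW.
  have -> : D ^+ 2 / (2 * lam) * G = lam * m ^+ 2 / 8 * G^-1.
    by rewrite DE; field; rewrite !gt_eqF.
  rewrite ler_piMr ?invf_le1// divr_ge0// mulr_ge0 ?sqr_ge0// ltW//.
have s3 : lam * m ^+ 2 <= lam * \sum_j v j 0 ^+ 2 by rewrite ler_pM2l.
have s4 := Hg v.
have s5 : 0 < lam * m ^+ 2 by rewrite mulr_gt0// exprn_gt0.
lra.
Qed.

(** Stands in for a minimum of positive thresholds over [I], which may be empty. *)
Lemma near_right_ex (R : realType) (I : finType) (P : I -> R -> Prop) :
  (forall i, \forall e \near 0^'+, P i e) ->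
  exists2 e : R, 0 < e & forall i, P i e.
Proof.
move=> H; have HF := filter_forall (at_right_proper_filter 0) H.
by have [e [e0 Pe]] := filter_ex (filterI (nbhs_right_gt 0) HF); exists e.
Qed.

Lemma lure_dissipation (R : realType) n p (A : 'M[R]_n) (B : 'M[R]_(n, p))
    (C : 'M[R]_(p, n)) (psi : 'I_p -> R -> R) (lp lm : 'I_p -> R) :
  lyap_diag_stable (C *m B) ->
  (forall i, 0 < lp i) -> (forall i, psi i s @[s --> 0^'+] --> lp i) ->
  (forall i, lm i < 0) -> (forall i, psi i s @[s --> 0^'-] --> lm i) ->
  exists g : 'I_p -> R, (forall i, 0 < g i) /\ exists rho c : R,
    [/\ 0 < rho, 0 < c & forall x v, enorm x <= rho -> C *m x != 0 ->
      lure_F A B C psi x v -> exists w : 'I_p -> R,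
      \sum_i g i * vee_slope (lp i) (lm i) (w i) ((C *m x) i 0) *
        (C *m v) i 0 <= - c].
Proof.
move=> /lyap_diag_stable_coercive[g [g0 [lam lam0 Hg]]] lp0 lpE lm0 lmE.
exists g; split=> //.
have [m m0 Hm] : exists2 m : R, 0 < m & forall i, m <= lp i /\ m <= - lm i.
  apply: near_right_ex => i; apply: filterI; apply: nbhs_right_le => //.
  by rewrite oppr_gt0.
have [D [c [D0 c0 Hdis]]] := coercive_dissipation lam0 m0 Hg.
have [K1 K10 HK1] := mulmx_le_enorm (C *m A).
have [K2 K20 HK2] := mulmx_le_enorm (C *m B).
have [K3 K30 HK3] := mulmx_le_enorm C.
have p0 : (0 : R) < p%:R + 1 by rewrite ltr_wpDl.
(* Chosen so that coordinatewise errors of size [e] in [w - h] move [C B (w - h)] by at most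
   [D / 2]. *)
pose e := D / 2 / (K2 * (p%:R + 1)).
have e0 : 0 < e by rewrite !divr_gt0// mulr_gt0.
have [eta eta0 Heta] : exists2 eta : R, 0 < eta & forall i,
    (forall s w, 0 < s < eta -> kras (psi i) s w -> `|w - lp i| <= e) /\
    (forall s w, - eta < s < 0 -> kras (psi i) s w -> `|w - lm i| <= e).
  apply: near_right_ex => i; apply: filterI.
    exact: kras_near_right (lpE i) e0.
  exact: kras_near_left (lmE i) e0.
(* The first bound makes [C A x] at most [D / 2] coordinatewise, the second puts every output
   coordinate in the range of [Heta]. *)
exists (Num.min (D / 2 / K1) (eta / 2 / K3)), c; split=> //.
  by rewrite lt_min !divr_gt0.
move=> x v; rewrite le_min !ler_pdivlMr// => /andP[x1 x3] Cx [w /= wk <-].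
(* Using the Krasovskii selection as the free slope makes [w - h] vanish at the coordinates where
   the output is 0. *)
exists (fun i => w i 0).
pose h : 'cV[R]_p :=
  \col_i vee_slope (lp i) (lm i) (w i 0) ((C *m x) i 0).
have y_lt i : `|(C *m x) i 0| < eta.
  apply: le_lt_trans (HK3 x i) _; lra.
have wh i : `|(w - h) i 0| <= e.
  have -> : (w - h) i 0 =
      w i 0 - vee_slope (lp i) (lm i) (w i 0) ((C *m x) i 0).
    by rewrite 2!mxE [h i 0]mxE.
  rewrite /vee_slope.
  have [Hr Hl] := Heta i; have := y_lt i; rewrite ltr_norml => /andP[y1 y2].
  have [y0|y0|y0] := ltgtP 0 ((C *m x) i 0).
  - by apply: (Hr _ _ _ (wk i)); rewrite y0.
  - by apply: (Hl _ _ _ (wk i)); rewrite y0 y1.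
  - by rewrite subrr normr0 ltW.
have -> : C *m (A *m x - B *m w) =
    (C *m A *m x - C *m B *m (w - h)) - C *m B *m h.
  by rewrite !mulmxBr !mulmxA -addrA -opprD subrK.
under eq_bigr => i _.
  have -> : vee_slope (lp i) (lm i) (w i 0) ((C *m x) i 0) = h i 0.
    by rewrite [RHS]mxE.
  over.
apply: Hdis => [i|].
  rewrite !mxE.
  have d1 : `|(C *m A *m x) i 0| <= D / 2.
    apply: le_trans (HK1 x i) _; lra.
  have d2 : `|(C *m B *m (w - h)) i 0| <= D / 2.
    apply: le_trans (HK2 _ i) _.
    have : enorm (w - h) <= e * (p%:R + 1).
      apply: le_trans (enorm_le_sum _) _.
      apply: (@le_trans _ _ (\sum_(i < p) e)); first exact: ler_sum.
      by rewrite sumr_const card_ord mulrDr mulr1 mulr_natr lerDl ltW.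
    rewrite -(ler_pM2l K20) => /le_trans; apply.
    by rewrite /e mulrCA mulfVK// gt_eqF// mulr_gt0.
  have := ler_normB ((C *m A *m x) i 0) ((C *m B *m (w - h)) i 0).
  rewrite !mxE in d1 d2 * => h1; lra.
have [i yi] : exists i, (C *m x) i 0 != 0.
  apply/existsP; apply: contraR Cx; rewrite negb_exists => /forallP H.
  by apply/eqP/colP => i; rewrite [RHS]mxE; apply/eqP; rewrite -[_ == _]negbK.
exists i; have [m1 m2] := Hm i; rewrite mxE /vee_slope.
have [y0|y0|y0] := ltgtP 0 ((C *m x) i 0).
- by rewrite gtr0_norm.
- by rewrite ltr0_norm.
- by rewrite -y0 eqxx in yi.
Qed.

(** * Descent of the Lyapunov function along solutions *)

Lemma countable_negligible (R : realType) (N : set R) :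
  countable N -> (@lebesgue_measure R).-negligible N.
Proof.
move=> cN; exists N; split=> //; last exact: countable_lebesgue_measure0.
by apply: countable_measurable => // t; exact: measurable_set1.
Qed.

Definition vee_sum (R : realType) p (g lp lm : 'I_p -> R) (y : 'cV[R]_p) : R :=
  \sum_i g i * vee (lp i) (lm i) (y i 0).

Lemma has_slope_mulmx (R : realType) n p (C : 'M[R]_(p, n)) (x : R -> 'cV[R]_n)
    t i :
  vderivable x t ->
  has_slope (fun s => (C *m x s) i 0) t ((C *m vderive x t) i 0).
Proof.
move=> dx.
have -> : (fun s => (C *m x s) i 0) = (fun s => \sum_j C i j * x s j 0).
  by apply/funext => s; rewrite mxE.
rewrite mxE; apply: has_slope_sum => j; apply: has_slopeZ.
by rewrite mxE; exact: derivable_has_slope (dx j).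
Qed.

Lemma vee_sum_lipschitz (R : realType) n p (C : 'M[R]_(p, n))
    (g lp lm : 'I_p -> R) :
  (forall i, 0 < g i) -> (forall i, 0 < lp i) -> (forall i, lm i < 0) ->
  exists2 L : R, 0 < L & forall x x' : 'cV[R]_n,
    `|vee_sum g lp lm (C *m x) - vee_sum g lp lm (C *m x')| <=
      L * enorm (x - x').
Proof.
move=> g0 lp0 lm0; have [K K0 HK] := mulmx_le_enorm C.
have gl i : 0 < g i * (lp i - lm i).
  by rewrite mulr_gt0// subr_gt0 (lt_trans (lm0 i)).
exists ((1 + \sum_i g i * (lp i - lm i)) * K).
  by rewrite mulr_gt0// ltr_pwDl// sumr_ge0// => i _; exact: ltW.
move=> x x'; rewrite /vee_sum -sumrB (le_trans (ler_norm_sum _ _ _))//.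
rewrite !mulrDl mul1r ler_wpDl//; first by rewrite mulr_ge0 ?enorm_ge0// ltW.
rewrite -mulrA mulr_suml; apply: ler_sum => i _.
rewrite -mulrBr normrM gtr0_norm// -!mulrA ler_pM2l//.
apply: le_trans (vee_lipschitz _ _ (lm0 i) (lp0 i)) _.
rewrite ler_pM2l; last by have := lp0 i; have := lm0 i; lra.
by have := HK (x - x') i; rewrite mulmxBr !mxE.
Qed.

Lemma loc_abs_cont_lipschitz (R : realType) n (T : \bar R) (x : R -> 'cV[R]_n)
    (V : 'cV[R]_n -> R) (L a b : R) :
  0 < L -> (forall z z', `|V z - V z'| <= L * enorm (z - z')) ->
  loc_abs_cont T x -> tdom T a -> tdom T b -> abs_cont a b (V \o x).
Proof.
move=> L0 LV xac Ta Tb e e0; have [d d0 Hd] := xac a b Ta Tb _ (divr_gt0 e0 L0).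
exists d => // k u v uv dis sm.
apply: le_lt_trans (_ : L * \sum_i enorm (x (v i) - x (u i)) < e).
  by rewrite mulr_sumr; apply: ler_sum => i _; exact: LV.
by rewrite mulrC -ltr_pdivlMr//; exact: Hd.
Qed.

Lemma tdom_itv (R : realType) (T : \bar R) (b t : R) :
  tdom T b -> 0 <= t <= b -> tdom T t.
Proof.
move=> [b0 bT] /andP[t0 tb]; split=> //.
by apply: le_lt_trans bT; rewrite lee_fin.
Qed.

(** The maximum reflects two cases. If the output vanishes at some time of [[a, b]], monotonicity
    from there on gives the value 0 at [b]; otherwise the rate [c] applies on the whole interval. *)
Lemma vee_sum_descent (R : realType) n p
    (F : 'cV[R]_n -> set 'cV[R]_n) (C : 'M[R]_(p, n))
    (g lp lm : 'I_p -> R) (rho c : R) :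
  (forall i, 0 < g i) -> (forall i, 0 < lp i) -> (forall i, lm i < 0) ->
  0 < c ->
  (forall x v, enorm x <= rho -> C *m x != 0 -> F x v ->
    exists w : 'I_p -> R,
      \sum_i g i * vee_slope (lp i) (lm i) (w i) ((C *m x) i 0) *
        (C *m v) i 0 <= - c) ->
  forall T x a b, is_solution F T x -> 0 <= a -> a <= b -> tdom T b ->
    (forall t, a <= t <= b -> enorm (x t) <= rho) ->
    vee_sum g lp lm (C *m x b) <=
      Num.max (vee_sum g lp lm (C *m x a) - c * (b - a)) 0.
Proof.
move=> g0 lp0 lm0 c0 dis T x a b [T0 [xac [N [N0 HN]]]] a0 ab Tb xrho.
have Tt t : a <= t <= b -> tdom T t.
  move=> /andP[ta tb]; apply: tdom_itv Tb _.
  by rewrite tb (le_trans a0 ta).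
pose Z := \bigcup_(i in [set: 'I_p]) isolated [set t | (C *m x t) i 0 = 0].
have Z0 : (@lebesgue_measure R).-negligible Z.
  apply: countable_negligible; apply: bigcup_countable => // i _.
  exact: countable_isolated.
have NZ0 := negligibleU N0 Z0.
have [L L0 HL] := vee_sum_lipschitz C g0 lp0 lm0.
pose V z := vee_sum g lp lm (C *m z).
have Vac s t : a <= s -> s <= t -> t <= b -> abs_cont s t (V \o x).
  move=> as_ st tb; apply: (loc_abs_cont_lipschitz L0 HL xac).
    by apply: Tt; rewrite as_ (le_trans st tb).
  by apply: Tt; rewrite tb (le_trans as_ st).
(* Off [Z] a vanishing output coordinate also has zero slope, so the formula holds for every [w], in
   particular for the one that [dis] provides. *)
have slope t : a <= t <= b -> ~ (N `|` Z) t -> forall w : 'I_p -> R,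
    has_slope (V \o x) t (\sum_i g i *
      vee_slope (lp i) (lm i) (w i) ((C *m x t) i 0) *
      (C *m vderive x t) i 0).
  move=> tab /not_orP[nN nZ] w; have [dx _] := HN t (Tt t tab) nN.
  apply: has_slope_sum => i; rewrite -mulrA; apply: has_slopeZ.
  apply: has_slope_vee => //; first exact: has_slope_mulmx.
  move=> yi0; apply/eqP/negPn/negP => d0; apply: nZ; exists i => //.
  exact: has_slope_isolated (has_slope_mulmx C i dx) d0 yi0.
have V_ge0 z : 0 <= V z.
  apply: sumr_ge0 => i _; rewrite mulr_ge0 ?(ltW (g0 i))//.
  have := @vee_ge _ (lp i) (lm i) 0 ((C *m z) i 0).
  rewrite mul0r; apply; first exact: ltW.
  by rewrite oppr_ge0 ltW.
have V_noninc s : a <= s <= b -> V (x b) <= V (x s).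
  move=> /andP[as_ sb]; rewrite -subr_le0 -[leRHS](mul0r (b - s)).
  apply: (abs_cont_slope_le sb (Vac s b as_ sb (lexx b)) NZ0) => t /andP[st tb] nt.
  have tab : a <= t <= b by rewrite tb (le_trans as_ st).
  have sl := slope t tab nt.
  have [y0|y0] := eqVneq (C *m x t) 0.
    (* At zero output every coordinate sits at its kink, and [w = 0] makes all terms vanish. *)
    exists 0 => //; have := sl (fun=> 0).
    rewrite big1// => i _.
    by rewrite y0 /vee_slope [(0 : 'cV[R]_p) i 0]mxE ltxx mulr0 mul0r.
  have [nN _] : ~ N t /\ ~ Z t by move/not_orP: nt.
  have [_ Fx] := HN t (Tt t tab) nN.
  have [w Hw] := dis _ _ (xrho t tab) y0 Fx.
  by eexists; [|exact: (sl w)]; rewrite (le_trans Hw)// oppr_le0 ltW.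
have [[t [tab y0]]|ny0] := pselect (exists t, a <= t <= b /\ C *m x t = 0).
  rewrite le_max; apply/orP; right.
  apply: le_trans (V_noninc t tab) _.
  by rewrite /V y0 /vee_sum big1// => i _; rewrite mxE vee0 mulr0.
rewrite le_max; apply/orP; left.
suff : V (x b) - V (x a) <= - c * (b - a) by rewrite /V; lra.
apply: (abs_cont_slope_le ab (Vac a b (lexx a) ab (lexx b)) NZ0) => t tab nt.
have [nN _] : ~ N t /\ ~ Z t by move/not_orP: nt.
have [_ Fx] := HN t (Tt t tab) nN.
have [|w Hw] := dis _ _ (xrho t tab) _ Fx.
  by apply/eqP => y0; apply: ny0; exists t.
by eexists; [exact: Hw|exact: slope].
Qed.

(** * Norm comparisons and class KL bounds *)

Lemma enorm_mulmx_le (R : realType) n p (C : 'M[R]_(p, n)) :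
  exists2 K : R, 0 < K & forall x : 'cV[R]_n, enorm (C *m x) <= K * enorm x.
Proof.
have [K K0 HK] := mulmx_le_enorm C.
exists ((p%:R + 1) * K); first by rewrite mulr_gt0// ltr_wpDl.
move=> x; apply: le_trans (enorm_le_sum _) _.
apply: (@le_trans _ _ (\sum_(i < p) K * enorm x)); first exact: ler_sum.
rewrite sumr_const card_ord -[leLHS]mulr_natl -mulrA mulrDl mul1r lerDl.
by rewrite mulr_ge0 ?enorm_ge0// ltW.
Qed.

Lemma enorm_eq0 (R : realType) n (x : 'cV[R]_n) : enorm x <= 0 -> x = 0.
Proof.
move=> x0; apply/colP => i; rewrite mxE; apply/eqP.
by rewrite -normr_le0 (le_trans (le_enorm x i)).
Qed.

Lemma vee_sum_bounds (R : realType) p (g lp lm : 'I_p -> R) :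
  (forall i, 0 < g i) -> (forall i, 0 < lp i) -> (forall i, lm i < 0) ->
  exists m L : R, [/\ 0 < m, 0 < L & forall y : 'cV[R]_p,
    m * enorm y <= vee_sum g lp lm y /\ vee_sum g lp lm y <= L * enorm y].
Proof.
move=> g0 lp0 lm0.
(* The upper bound is the Lipschitz estimate between [y] and 0, with the identity as output
   matrix. *)
have [L L0 HL] := vee_sum_lipschitz 1%:M g0 lp0 lm0.
have [m m0 Hm] : exists2 m : R, 0 < m & forall i,
    m <= g i * lp i /\ m <= g i * - lm i.
  apply: near_right_ex => i; apply: filterI; apply: nbhs_right_le.
    exact: mulr_gt0.
  by rewrite mulr_gt0// oppr_gt0.
exists m, L; split=> // y; split.
  apply: (@le_trans _ _ (m * \sum_i `|y i 0|)).
    by rewrite ler_pM2l// enorm_le_sum.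
  rewrite mulr_sumr; apply: ler_sum => i _; have [m1 m2] := Hm i.
  have -> : m * `|y i 0| = g i * (m / g i * `|y i 0|).
    by rewrite mulrA mulrCA divff ?mulr1// gt_eqF.
  rewrite ler_pM2l//; apply: vee_ge; rewrite ler_pdivrMr// mulrC//.
have := HL y 0; rewrite mulmx0 mul1mx subr0.
have -> : vee_sum g lp lm (0 : 'cV[R]_p) = 0.
  by rewrite /vee_sum big1// => i _; rewrite mxE vee0 mulr0.
by rewrite subr0 => /(le_trans (ler_norm _)).
Qed.

Lemma classKL_scale (R : realType) (b : R -> R -> R) (K : R) :
  0 < K -> classKL b -> classKL (fun r t => K * b r t).
Proof.
move=> K0 [bK [bdec blim]]; split; [|split].
- move=> t t0; have [bc [b00 binc]] := bK t t0; split; [|split].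
  + by move=> r; apply: cvgMr; exact: bc.
  + by rewrite b00 mulr0.
  + by move=> r s r0 rs; rewrite ltr_pM2l// binc.
- by move=> r r0 t s t0 ts; rewrite ler_pM2l// bdec.
- by move=> r r0; rewrite -(mulr0 K); apply: cvgMr; exact: blim.
Qed.

(** The natural bound [max (r - a t) 0] is not strictly increasing in [r], hence not of class KL;
    this hyperbola is. *)
Lemma classKL_fraction (R : realType) (K a : R) : 0 < K -> 0 < a ->
  classKL (fun r t => K * r / (1 + a * t)).
Proof.
move=> K0 a0.
have den t : 0 <= t -> 0 < 1 + a * t.
  by move=> t0; rewrite ltr_pwDl// mulr_ge0// ltW.
split; [|split].
- move=> t t0; have d0 := den t t0; split; [|split].
  + apply: continuous_subspaceT => r.
    by apply: cvgMl; apply: cvgMr; exact: cvg_id.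
  + by rewrite mulr0 mul0r.
  + by move=> r s _ rs; rewrite ltr_pM2r ?invr_gt0// ltr_pM2l.
- move=> r r0 t s t0 ts; rewrite ler_wpM2l//.
    by rewrite mulr_ge0// ltW.
  by rewrite lef_pV2 ?posrE ?den// ?(le_trans t0)// lerD2l ler_pM2l.
- move=> r r0; apply/cvgrPdist_le => e e0; near=> t.
  have t0 : 0 <= t by near: t; apply: nbhs_pinfty_ge; exact: num_real.
  have tb : K * r / (a * e) <= t by near: t; apply: nbhs_pinfty_ge; exact: num_real.
  rewrite sub0r normrN ger0_norm; last first.
    by rewrite divr_ge0 ?mulr_ge0 ?(ltW K0)// ltW// den.
  rewrite ler_pdivrMr ?den//.
  move: tb; rewrite ler_pdivrMr ?mulr_gt0// => tb; lra.
Unshelve. all: by end_near. Qed.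

(* A quantity decreasing at rate [c] from a value [v <= M] lies below the
   hyperbola [v / (1 + c t / M)], which is linear in [v]. *)
Lemma linear_decay_le_fraction (R : realType) (v M c t : R) :
  0 <= v -> v <= M -> 0 < M -> 0 < c -> 0 <= t ->
  Num.max (v - c * t) 0 <= v / (1 + c / M * t).
Proof.
move=> v0 vM M0 c0 t0.
have d0 : 0 < 1 + c / M * t by rewrite ltr_pwDl// mulr_ge0// divr_ge0// ltW.
rewrite ge_max divr_ge0 ?(ltW d0)// andbT ler_pdivlMr//.
have h1 : 0 <= c * t by rewrite mulr_ge0// ltW.
have h2 : v * (c / M * t) <= c * t.
  have -> : v * (c / M * t) = v / M * (c * t) by ring.
  by rewrite ler_piMl// ler_pdivrMr// mul1r.
have h3 : 0 <= c * t * (c / M * t).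
  by rewrite mulr_ge0// mulr_ge0// divr_ge0// ltW.
lra.
Qed.

(** * Finite-time and state-independent output stability *)

Theorem theorem2 (R : realType) (n p : nat)
    (A : 'M[R]_n) (B : 'M[R]_(n, p)) (C : 'M[R]_(p, n))
    (psi : 'I_p -> R -> R) (zeta : 'I_p -> \bar R) :
  (* Assumption 1 *)
  (forall i, piecewise_continuous (psi i)) ->
  (forall i, (0 < zeta i)%E /\ sector (zeta i) (psi i)) ->
  (* Assumption 3 *)
  lyap_diag_stable (C *m B) ->
  GAS (lure_F A B C psi) ->
  (forall i, exists2 l : R, 0 < l & psi i s @[s --> 0^'+] --> l) ->
  (forall i, exists2 l : R, l < 0 & psi i s @[s --> 0^'-] --> l) ->
  OFTS (lure_F A B C psi) C /\ SIoLAS (lure_F A B C psi) C.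
Proof.
move=> _ _ lds [fc [b bKL Hb]] Hp Hm.
have /choice[lp Hlp] : forall i, exists l : R,
    0 < l /\ psi i s @[s --> 0^'+] --> l.
  by move=> i; have [l] := Hp i; exists l.
have /choice[lm Hlm] : forall i, exists l : R,
    l < 0 /\ psi i s @[s --> 0^'-] --> l.
  by move=> i; have [l] := Hm i; exists l.
have lp0 i := (Hlp i).1; have lm0 i := (Hlm i).1.
have [g [g0 [rho [c [rho0 c0 dis]]]]] := lure_dissipation A lds lp0
  (fun i => (Hlp i).2) lm0 (fun i => (Hlm i).2).
have descent := vee_sum_descent g0 lp0 lm0 c0 dis.
have [K K0 HK] := enorm_mulmx_le C.
have [m [L [m0 L0 HmL]]] := vee_sum_bounds g0 lp0 lm0.
have [bK [bdec blim]] := bKL.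
split.
  split.
    (* Output stability is inherited from the state through [|C x| <= K |x|]. *)
    split=> //; exists (fun r t => K * b r t); first exact: classKL_scale.
    move=> T x sx t Tt; apply: le_trans (HK _) _.
    by rewrite ler_pM2l//; exact: Hb sx _ Tt.
  move=> x sx.
  have [T1 [T10 HT1]] : exists T1 : R, 0 <= T1 /\
      forall t, T1 <= t -> enorm (x t) <= rho.
    have /cvgrPdist_le/(_ rho rho0) := blim _ (enorm_ge0 (x 0)).
    (* The limit at infinity supplies only times strictly beyond its bound, hence the shift by
       one. *)
    move=> [T1 [_ HT1]]; exists (Num.max 0 (T1 + 1)).
    split; first by rewrite le_max lexx.
    move=> t; rewrite ge_max => /andP[t0 tT1].
    apply: le_trans (Hb _ _ sx t _) _; first by split=> //; exact: ltry.
    have := HT1 t; rewrite sub0r normrN => /(_ _)/(le_trans (ler_norm _)).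
    by apply; lra.
  set V1 := vee_sum g lp lm (C *m x T1).
  have V10 : 0 <= V1.
    by apply: le_trans (HmL _).1; rewrite mulr_ge0 ?enorm_ge0// ltW.
  (* Decreasing at rate [c] from [V1], the Lyapunov function needs at most [V1 / c] after [T1] to
     reach 0. *)
  exists (T1 + V1 / c); first by rewrite addr_ge0// divr_ge0// ltW.
  move=> t tT; have T1t : T1 <= t.
    by apply: le_trans tT; rewrite lerDl divr_ge0// ltW.
  apply: enorm_eq0; rewrite -(pmulr_rle0 _ m0).
  apply: le_trans (HmL _).1 _.
  apply: le_trans (descent _ _ _ _ sx T10 T1t _ _) _.
  - by split; [exact: le_trans T1t|exact: ltry].
  - by move=> s /andP[sT1 _]; exact: HT1.
  - move: tT; rewrite -lerBrDl ler_pdivrMr// ge_max lexx andbT => tT.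
    by rewrite -/V1; lra.
split=> //.
(* Continuity of [b] at [(0, 0)] in its first argument, with monotonicity in time, confines
   solutions from the [r]-ball to the [rho]-ball forever. *)
have [r r0 Hr] : exists2 r : R, 0 < r &
    forall s, 0 <= s -> s < r -> b s 0 <= rho.
  have [/subspace_continuousP bc [b00 _]] := bK 0 (lexx 0).
  have := bc 0; rewrite /= in_itv/= lexx => /(_ isT).
  move=> /cvgrPdist_le/(_ rho rho0); rewrite near_withinE.
  move=> /nbhs_ballP[r /= r0 Hr]; exists r => // s s0 sr.
  have := Hr s; rewrite /ball/= sub0r normrN ger0_norm// => /(_ sr).
  rewrite in_itv/= s0 => /(_ isT); rewrite /from_subspace /= b00 sub0r normrN.
  exact: le_trans (ler_norm _).
exists r; split=> //.
have M0 : 0 < L * (K * r) by rewrite !mulr_gt0.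
(* [L / m] comes from passing from [|y|] to the Lyapunov function and back; [L * (K * r)] bounds its
   initial value on the [r]-ball. *)
exists (fun s t => L / m * s / (1 + c / (L * (K * r)) * t)).
  by apply: classKL_fraction; rewrite divr_gt0.
move=> T x sx xr t Tt; have [t0 _] := Tt.
set V0 := vee_sum g lp lm (C *m x 0).
have V00 : 0 <= V0.
  by apply: le_trans (HmL _).1; rewrite mulr_ge0 ?enorm_ge0// ltW.
have V0M : V0 <= L * (K * r).
  apply: le_trans (HmL _).2 _; rewrite ler_pM2l//.
  by apply: le_trans (HK _) _; rewrite ler_pM2l// ltW.
have xrho s : 0 <= s <= t -> enorm (x s) <= rho.
  move=> s0t; apply: le_trans (Hb _ _ sx s (tdom_itv Tt s0t)) _.
  have /andP[s0 _] := s0t.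
  apply: le_trans (bdec _ (enorm_ge0 _) 0 s (lexx 0) s0) _.
  by apply: Hr; rewrite ?enorm_ge0.
have V0t := descent _ _ _ _ sx (lexx 0) t0 Tt xrho.
rewrite subr0 -/V0 in V0t.
have d0 : 0 < 1 + c / (L * (K * r)) * t.
  by rewrite ltr_pwDl// mulr_ge0// divr_ge0// ltW.
rewrite -(ler_pM2l m0); apply: le_trans (HmL _).1 _.
apply: le_trans V0t _.
apply: le_trans (linear_decay_le_fraction V00 V0M M0 c0 t0) _.
have -> : m * (L / m * enorm (C *m x 0) / (1 + c / (L * (K * r)) * t)) =
    L * enorm (C *m x 0) / (1 + c / (L * (K * r)) * t).
  by rewrite !mulrA [m * L]mulrC mulfK// gt_eqF.
by rewrite ler_pM2r ?invr_gt0//; exact: (HmL _).2.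
Qed.
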